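(* Let $A\in\mathcal{V}$ and $\theta\in Con(A)$. The following are equivalent: (1) $\theta$ has $CBLP$; (2) for all congruences $\phi,\psi$ of $A$ with $\phi\vee\psi=\nabla_A$ and $[\phi,\psi]\subseteq\theta$, there exists $\alpha\in B(Con(A))$ with $\alpha\subseteq\theta\vee\phi$ and $\neg\alpha\subseteq\theta\vee\psi$; (3) for all congruences $\phi,\psi$ of $A$ with $\phi\vee\psi=\nabla_A$ and $[\phi,\psi]=\theta$, there exists $\alpha\in B(Con(A))$ with $\alpha\subseteq\theta\vee\phi$ and $\neg\alpha\subseteq\theta\vee\psi$; (4) for every maximal congruence $\phi$ of $A$, $|B(Con(A/(\theta\vee\phi^{\diamond})))|\leq 2$.
   Context: $\mathcal{V}$ is a congruence modular, semidegenerate variety (no nontrivial algebra has a one-element subalgebra) of finite signature. For $B\in\mathcal{V}$: $Con(B)$ is its congruence lattice with bounds $\Delta_B,\nabla_B$, $[\cdot,\cdot]$ the Freese–McKenzie commutator, $K(B)$ the compact congruences. A congruence $\phi\neq\nabla_B$ is prime if $[\alpha,\beta]\subseteq\phi$ implies $\alpha\subseteq\phi$ or $\beta\subseteq\phi$; $\rho(\theta)$ is the intersection of primes containing $\theta$. $B(Con(B))$ is the Boolean algebra of complemented elements of $Con(B)$, with complement $\neg\alpha$. When $K(B)$ is closed under the commutator, the reticulation $L(B)=K(B)/{\equiv}$ ($\alpha\equiv\beta$ iff $\rho(\alpha)=\rho(\beta)$) is a bounded distributive lattice with canonical map $\lambda_B$, mapping $B(Con(B))$ injectively into $B(L(B))$;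 the reticulation preserves the Boolean center if this map is onto $B(L(B))$. Standing assumption: for every $B\in\mathcal{V}$, $K(B)$ is closed under the commutator and the reticulation of $B$ preserves the Boolean center. For $\phi\in Con(A)$, $\phi^{\diamond}=\bigvee\{\alpha\in B(Con(A)):\alpha\subseteq\phi\}$. A congruence $\theta$ of $A$ has $CBLP$ if for every $\beta\in B(Con(A/\theta))$ there is $\alpha\in B(Con(A))$ with $(\alpha\vee\theta)/\theta=\beta$. *)

(* Defs.v *)
From mathcomp Require Import all_boot.
From Stdlib Require Import ClassicalEpsilon.
From Stdlib Require List.

Set Implicit Arguments.
Unset Strict Implicit.
Unset Printing Implicit Defensive.

Record signature := Signature { sym : finType; ar : sym -> nat }.

Record algebra (S : signature) := Algebra {
  car :> Type;
  op : forall i : sym S, ('I_(ar i) -> car) -> car }.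

Inductive term (S : signature) : Type :=
  | Var : nat -> term S
  | App : forall i : sym S, ('I_(ar i) -> term S) -> term S.

Fixpoint eval (S : signature) (A : algebra S) (v : nat -> A) (t : term S) : A :=
  match t with
  | Var n => v n
  | App i f => @op S A i (fun k => eval v (f k))
  end.

(* A variety is given (Birkhoff) by a set of identities E; A is in V iff A |= E. *)
Definition models (S : signature) (E : term S -> term S -> Prop) (A : algebra S) :=
  forall s t, E s t -> forall v : nat -> A, eval v s = eval v t.

Definition prel (T : Type) := T -> T -> Prop.
Definition psubrel T (R R' : prel T) := forall x y, R x y -> R' x y.
Definition releq T (R R' : prel T) := forall x y, R x y <-> R' x y.

Definition is_con (S : signature) (A : algebra S) (R : prel A) : Prop :=
  (forall x, R x x) /\ (forall x y, R x y -> R y x) /\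
  (forall x y z, R x y -> R y z -> R x z) /\
  (forall i (f g : 'I_(ar i) -> A), (forall k, R (f k) (g k)) -> R (@op S A i f) (@op S A i g)).

Definition Delta (T : Type) : prel T := fun x y => x = y.
Definition Nabla (T : Type) : prel T := fun _ _ => True.
Definition meet T (R R' : prel T) : prel T := fun x y => R x y /\ R' x y.

Definition cg (S : signature) (A : algebra S) (U : prel A) : prel A :=
  fun x y => forall T, is_con T -> psubrel U T -> T x y.

Definition join (S : signature) (A : algebra S) (R R' : prel A) : prel A :=
  cg (fun x y => R x y \/ R' x y).

Definition is_compl (S : signature) (A : algebra S) (a b : prel A) : Prop :=
  is_con a /\ is_con b /\ releq (meet a b) (@Delta A) /\ releq (join a b) (@Nabla A).

Definition boolean (S : signature) (A : algebra S) (a : prel A) : Prop :=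
  exists b, is_compl a b.

Definition compact (S : signature) (A : algebra S) (a : prel A) : Prop :=
  is_con a /\
  forall (J : Type) (F : J -> prel A), (forall j, is_con (F j)) ->
    psubrel a (cg (fun x y => exists j, F j x y)) ->
    exists s : list J, psubrel a (cg (fun x y => exists j, List.In j s /\ F j x y)).

Definition mixv (T : Type) (m : nat) (a c : nat -> T) : nat -> T :=
  fun n => if n < m then a n else c n.

Definition centralizes (S : signature) (A : algebra S) (al be de : prel A) : Prop :=
  forall (t : term S) (m : nat) (a b c d : nat -> A),
    (forall n, al (a n) (b n)) -> (forall n, be (c n) (d n)) ->
    de (eval (mixv m a c) t) (eval (mixv m a d) t) ->
    de (eval (mixv m b c) t) (eval (mixv m b d) t).

Definition comm (S : signature) (A : algebra S) (al be : prel A) : prel A :=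
  fun x y => forall de, is_con de -> centralizes al be de -> de x y.

Definition prime_con (S : signature) (A : algebra S) (p : prel A) : Prop :=
  is_con p /\ ~ releq p (@Nabla A) /\
  forall a b, is_con a -> is_con b -> psubrel (comm a b) p -> psubrel a p \/ psubrel b p.

Definition rho (S : signature) (A : algebra S) (th : prel A) : prel A :=
  fun x y => forall p, prime_con p -> psubrel th p -> p x y.

Definition maximal_con (S : signature) (A : algebra S) (p : prel A) : Prop :=
  is_con p /\ ~ releq p (@Nabla A) /\
  forall q, is_con q -> psubrel p q -> releq q p \/ releq q (@Nabla A).

Definition diamond (S : signature) (A : algebra S) (phi : prel A) : prel A :=
  cg (fun x y => exists al, boolean al /\ psubrel al phi /\ al x y).

Definition qcar (S : signature) (A : algebra S) (th : prel A) : Type :=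
  { P : A -> Prop | exists a, P = th a }.

Definition cls (S : signature) (A : algebra S) (th : prel A) (a : A) : qcar th :=
  exist _ (th a) (ex_intro _ a erefl).

Definition rep (S : signature) (A : algebra S) (th : prel A) (X : qcar th) : A :=
  proj1_sig (constructive_indefinite_description _ (proj2_sig X)).

Definition quot (S : signature) (A : algebra S) (th : prel A) : algebra S :=
  @Algebra S (qcar th) (fun i f => cls th (@op S A i (fun k => rep (f k)))).

Definition qcon (S : signature) (A : algebra S) (th al : prel A) : prel (quot th) :=
  fun X Y => exists a b, X = cls th a /\ Y = cls th b /\ join al th a b.

Definition modular_con (S : signature) (A : algebra S) : Prop :=
  forall a b c : prel A, is_con a -> is_con b -> is_con c -> psubrel a c ->
    releq (join a (meet b c)) (meet (join a b) c).

Definition congruence_modular (S : signature) (E : term S -> term S -> Prop) :=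
  forall B : algebra S, models E B -> modular_con B.

Definition semidegenerate (S : signature) (E : term S -> term S -> Prop) :=
  forall B : algebra S, models E B -> (exists x y : B, x <> y) ->
    ~ exists x : B, forall i (f : 'I_(ar i) -> B), (forall k, f k = x) -> @op S B i f = x.

Definition K_comm_closed (S : signature) (B : algebra S) : Prop :=
  forall a b : prel B, compact a -> compact b -> compact (comm a b).

(* lambda_B : B(Con(B)) -> B(L(B)) is onto.  In L(B) = K(B)/==, the class of a
   compact a is complemented iff there is a compact b with
   [a] \/ [b] = [Nabla] and [a] /\ [b] = [[a,b]] = [Delta]. *)
Definition reticulation_preserves_bc (S : signature) (B : algebra S) : Prop :=
  forall a : prel B, compact a ->
    (exists b, compact b /\ releq (rho (join a b)) (rho (@Nabla B))
                         /\ releq (rho (comm a b)) (rho (@Delta B))) ->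
    exists al, boolean al /\ compact al /\ releq (rho al) (rho a).

Definition standing (S : signature) (E : term S -> term S -> Prop) :=
  congruence_modular E /\ semidegenerate E /\
  forall B : algebra S, models E B -> K_comm_closed B /\ reticulation_preserves_bc B.

Definition CBLP (S : signature) (A : algebra S) (th : prel A) : Prop :=
  forall be : prel (quot th), boolean be ->
    exists al : prel A, boolean al /\ releq (@qcon S A th al) be.

Definition at_most_two_boolean (S : signature) (B : algebra S) : Prop :=
  forall a b c : prel B, boolean a -> boolean b -> boolean c ->
    releq a b \/ releq a c \/ releq b c.

(* Main.v *)
(* All commutator theory comes from the algebra of pairs of a congruence b, a
   subalgebra of A^2, and its congruence [delta_rel a], generated by identifying
   (x, x) with (y, y) whenever a x y. Centrality says that [delta_rel a] saturates
   the pairs lying in d. Modularity of the congruence lattice of the pair algebra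
   (the shifting lemma, applied to [delta_rel a] and the two projection kernels)
   then shows that centrality is symmetric and monotone in d, so the commutator is
   symmetric and additive; semidegeneracy gives [Nabla, a] = a. It follows that
   f \/ g = Nabla implies f /\ g = [f, g], so that (2) and (3) are statements about
   complements in the interval [th, Nabla].

   For (2) => (4), a complemented pair of A/(th \/ phi^diamond) is approximated by
   compact f0, g0; as [f0, g0] is compact it lies in th \/ al for one Boolean
   al <= phi, and splitting off al leads back to (2). For (4) => (2), each maximal
   congruence m fails to contain some Boolean e below th \/ phi or th \/ psi; since
   Nabla is compact, finitely many such e already cover Nabla, and grouping them
   gives the required complementary pair. *)
From mathcomp Require Import all_boot boolp.
From mathcomp Require classical_sets.
Require Import Defs.

Set Implicit Arguments.
Unset Strict Implicit.
Unset Printing Implicit Defensive.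

Local Notation "R <=r R'" := (psubrel R R') (at level 70, no associativity).

(** * Congruences as a lattice: meets, joins and complements *)

Section CongruenceLattice.
Variables (S : signature) (A : algebra S).
Implicit Types a b c d : prel A.

Lemma psubrel_trans b a c : a <=r b -> b <=r c -> a <=r c.
Proof. by move=> ab bc x y /ab /bc. Qed.

Lemma releq_ext a b : releq a b -> a = b.
Proof. by move=> ab; apply/funext=> x; apply/funext=> y; apply/propext. Qed.

Lemma psubrel_anti a b : a <=r b -> b <=r a -> a = b.
Proof. by move=> ab ba; apply: releq_ext => x y; split; [exact: ab|exact: ba]. Qed.

Lemma releq_nabla a : releq a (@Nabla A) <-> @Nabla A <=r a.
Proof. by split=> [h x y _|h x y]; [apply/h|split=> // _; exact: h]. Qed.

Lemma con_refl a : is_con a -> forall x, a x x. Proof. by case. Qed.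

Lemma con_sym a : is_con a -> forall x y, a x y -> a y x.
Proof. by case=> _ []. Qed.

Lemma con_trans a : is_con a -> forall y x z, a x y -> a y z -> a x z.
Proof. by case=> _ [_ [h _]] y x z; apply: h. Qed.

Lemma con_op a : is_con a -> forall i (f g : 'I_(ar i) -> A),
  (forall k, a (f k) (g k)) -> a (op f) (op g).
Proof. by case=> _ [_ []]. Qed.

Lemma con_delta : is_con (@Delta A).
Proof.
split=> [x|]; first by [].
split=> [x y ->//|]; split=> [x y z -> ->//|i f g fg].
by rewrite (funext fg).
Qed.

Lemma con_nabla : is_con (@Nabla A). Proof. by []. Qed.

Lemma delta_le a : is_con a -> @Delta A <=r a.
Proof. by move=> ca x y ->; exact: con_refl. Qed.

Lemma con_meet a b : is_con a -> is_con b -> is_con (meet a b).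
Proof.
move=> ca cb; split=> [x|]; first by split; exact: con_refl.
split=> [x y [? ?]|]; first by split; exact: con_sym.
split=> [x y z [h1 h2] [h3 h4]|i f g fg].
  by split; [exact: con_trans h1 h3|exact: con_trans h2 h4].
by split; apply: con_op => // k; case: (fg k).
Qed.

Lemma con_cg (U : prel A) : is_con (cg U).
Proof.
split=> [x T cT _|]; first exact: con_refl.
split=> [x y h T cT UT|]; first by apply: con_sym => //; exact: h.
split=> [x y z h h' T cT UT|i f g fg T cT UT].
  by apply: (@con_trans _ cT y); [exact: h|exact: h'].
by apply: con_op => // k; exact: fg.
Qed.

Lemma cg_ub (U : prel A) : U <=r cg U.
Proof. by move=> x y h T _; apply. Qed.

Lemma cg_lub (U : prel A) c : is_con c -> U <=r c -> cg U <=r c.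
Proof. by move=> cc Uc x y; apply. Qed.

Lemma con_join a b : is_con (join a b). Proof. exact: con_cg. Qed.

Lemma join_ubl a b : a <=r join a b.
Proof. by move=> x y h; apply: cg_ub; left. Qed.

Lemma join_ubr a b : b <=r join a b.
Proof. by move=> x y h; apply: cg_ub; right. Qed.

Lemma join_lub a b c : is_con c -> a <=r c -> b <=r c -> join a b <=r c.
Proof. by move=> cc ac bc; apply: cg_lub => // x y [/ac|/bc]. Qed.

Lemma le_joinl a b c : a <=r b -> a <=r join b c.
Proof. by move=> ab; apply: psubrel_trans ab (@join_ubl _ _). Qed.

Lemma le_joinr a b c : a <=r c -> a <=r join b c.
Proof. by move=> ac; apply: psubrel_trans ac (@join_ubr _ _). Qed.

Lemma join_mono a b c d : a <=r c -> b <=r d -> join a b <=r join c d.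
Proof.
by move=> ac bd; apply: join_lub (con_join _ _) _ _; [exact: le_joinl|exact: le_joinr].
Qed.

Lemma meet_lel a b : meet a b <=r a. Proof. by move=> x y []. Qed.

Lemma meet_ler a b : meet a b <=r b. Proof. by move=> x y []. Qed.

Lemma meet_glb a b c : c <=r a -> c <=r b -> c <=r meet a b.
Proof. by move=> ca cb x y h; split; [exact: ca|exact: cb]. Qed.

Lemma is_complP a b : is_compl a b <->
  [/\ is_con a, is_con b, meet a b <=r @Delta A & @Nabla A <=r join a b].
Proof.
split=> [[ca [cb [mab jab]]]|[ca cb mab jab]].
  by split=> //; [move=> x y /mab|apply/releq_nabla].
split=> //; split=> //; split; last exact/releq_nabla.
by move=> x y; split=> [/mab//|->]; split; exact: con_refl.
Qed.

Lemma join_sym a b : join a b <=r join b a.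
Proof. by apply: join_lub (con_join _ _) _ _; [exact: join_ubr|exact: join_ubl]. Qed.

Lemma is_compl_sym a b : is_compl a b -> is_compl b a.
Proof.
move=> /is_complP[ca cb mab jab]; apply/is_complP; split=> //.
  by move=> x y [h1 h2]; apply: mab.
exact: psubrel_trans jab (@join_sym _ _).
Qed.

Lemma con_boolean a : boolean a -> is_con a. Proof. by case=> b []. Qed.

Lemma boolean_delta : boolean (@Delta A).
Proof.
exists (@Nabla A); apply/is_complP.
by split; [exact: con_delta|exact: con_nabla|exact: meet_lel|exact: join_ubr].
Qed.

Lemma boolean_nabla : boolean (@Nabla A).
Proof.
exists (@Delta A); apply/is_complP.
by split; [exact: con_nabla|exact: con_delta|exact: meet_ler|exact: join_ubl].
Qed.

(** * Joins through transitive closures, and the shifting lemma *)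

Fixpoint chain (R : prel A) n : prel A :=
  if n is n'.+1 then fun x z => exists2 y, R x y & chain R n' y z else @Delta A.

Definition tclos (R : prel A) : prel A := fun x y => exists n, chain R n x y.

Lemma chain_cat R m n y x z : chain R m x y -> chain R n y z -> chain R (m + n) x z.
Proof.
elim: m x => [|m IH] x /=; first by move=> ->.
by case=> w xw wy yz; exists w => //; exact: IH.
Qed.

Lemma chain_pad (R : prel A) m n x y : (forall z, R z z) -> m <= n ->
  chain R m x y -> chain R n x y.
Proof.
move=> Rxx /subnKC <- xy; apply: chain_cat xy _.
by elim: (n - m) => [|k IH] //=; exists y.
Qed.

Lemma tclos_sub R : R <=r tclos R.
Proof. by move=> x y h; exists 1; exists y. Qed.

(* Reflexivity lets chains be padded to a common length, so that the transitive
   closure inherits compatibility with operations of any finite arity. *)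
Lemma con_tclos (R : prel A) : (forall x, R x x) -> (forall x y, R x y -> R y x) ->
  (forall i (f g : 'I_(ar i) -> A), (forall k, R (f k) (g k)) -> R (op f) (op g)) ->
  is_con (tclos R).
Proof.
move=> Rxx Rsym Rop; split=> [x|]; first by exists 0.
split=> [x y [n]|].
  elim: n x => [|n IH] x /=; first by move=> ->; exists 0.
  case=> z /Rsym zx /IH [m yz]; exists (m + 1).
  by apply: chain_cat yz _; exists x.
split=> [x y z [m xy] [n yz]|i f g fg]; first by exists (m + n); exact: chain_cat xy yz.
have [N hN] := choice fg.
exists (\max_k N k).
have {}hN k : chain R (\max_k N k) (f k) (g k).
  by apply: chain_pad (hN k) => //; exact: leq_bigmax.
elim: (\max_k _) f {fg} hN => [|n IH] f h /=; first by rewrite (funext h).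
have /choice[e he] : forall k, exists y, R (f k) y /\ chain R n y (g k).
  by move=> k; case: (h k) => y; exists y.
by exists (op e); [apply: Rop|apply: IH] => k; case: (he k).
Qed.

Lemma tclos_saturated (R : prel A) (P : A -> Prop) :
  (forall x y, R x y -> P x -> P y) -> forall x y, tclos R x y -> P x -> P y.
Proof.
move=> RP x y [n]; elim: n x => [|n IH] x /=; first by move=> ->.
by case=> z /RP xz zy /xz; exact: IH.
Qed.

(** Having the same truth value under [P] need not be a congruence, so minimality of the join cannot
    be applied to it directly. Instead the join lies in the transitive closure of the composite
    a;b;a, a symmetric composite each of whose steps preserves [P]. *)
Lemma join_saturated a b (P : A -> Prop) : is_con a -> is_con b ->
  (forall x y, a x y -> P x -> P y) -> (forall x y, b x y -> P x -> P y) ->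
  forall x y, join a b x y -> P x -> P y.
Proof.
move=> ca cb aP bP x y xy.
pose R : prel A := fun x y => exists z w, [/\ a x z, b z w & a w y].
apply: (@tclos_saturated R) => [u v [z [w [uz zw wv]]] Pu|].
  by apply: (aP _ _ wv); apply: (bP _ _ zw); apply: (aP _ _ uz).
apply: xy => [|u v [uv|uv]].
- apply: con_tclos => [u|u v [z [w [uz zw wv]]]|i f g fg].
  + by exists u, u; split; exact: con_refl.
  + by exists w, z; split; exact: con_sym.
  + have /choice[e1 h1] := fg; have /choice[e2 h2] := h1.
    by exists (op e1), (op e2); split; apply: con_op => // k; case: (h2 k).
- by apply: tclos_sub; exists v, v; split=> //; exact: con_refl.
- by apply: tclos_sub; exists u, v; split=> //; exact: con_refl.
Qed.

(** Gumm's shifting lemma. Going round the parallelogram puts (z, u) in ((b /\ c) \/ a) /\ b, which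
    by modularity is (b /\ c) \/ (a /\ b), and both parts lie in [c]. *)
Lemma shifting a b c x y z u : modular_con A -> is_con a -> is_con b -> is_con c ->
  meet a b <=r c -> a x z -> a y u -> b x y -> b z u -> c x y -> c z u.
Proof.
move=> mA ca cb cc abc xz yu xy zu cxy.
have cbc := con_meet cb cc.
have : meet (join (meet b c) a) b z u.
  split=> //; have cj := con_join (meet b c) a.
  apply: (con_trans cj) (_ : join _ _ x u).
    by apply: join_ubr; exact: con_sym.
  apply: (con_trans cj) (_ : join _ _ y u); last exact: join_ubr.
  by apply: join_ubl.
move=> /(mA _ _ _ cbc ca cb (@meet_lel _ _)).
by apply: join_lub => //; exact: meet_ler.
Qed.

End CongruenceLattice.

(** * The term condition, expressed by matrices *)

Section Commutator.
Variables (S : signature) (A : algebra S).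
Implicit Types a b c d : prel A.

(* [matrix a b p q r s] concerns the 2x2 matrix with rows (p, q) and (r, s): its
   columns are a-related and its rows b-related. *)
Inductive matrix a b : A -> A -> A -> A -> Prop :=
  | MatrixCol x y of a x y : matrix a b x x y y
  | MatrixRow u v of b u v : matrix a b u v u v
  | MatrixOp i (p q r s : 'I_(ar i) -> A) of
      (forall k, matrix a b (p k) (q k) (r k) (s k)) :
      matrix a b (op p) (op q) (op r) (op s).

Definition invariant a b d := forall p q r s, matrix a b p q r s -> d p q -> d r s.

Fixpoint tsubst (u : nat -> term S) (t : term S) : term S :=
  match t with
  | Var n => u n
  | App i f => App (fun k => tsubst u (f k))
  end.

Lemma eval_tsubst (v : nat -> A) u t : eval v (tsubst u t) = eval (fun n => eval v (u n)) t.
Proof. by elim: t => //= i f IH; congr op; apply/funext. Qed.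

Lemma eval_matrix a b t m (e e' f f' : nat -> A) :
  (forall n, a (e n) (e' n)) -> (forall n, b (f n) (f' n)) ->
  matrix a b (eval (mixv m e f) t) (eval (mixv m e f') t)
             (eval (mixv m e' f) t) (eval (mixv m e' f') t).
Proof.
move=> he hf; elim: t => [n|i g IH] /=; last by apply: MatrixOp.
by rewrite /mixv; case: ifP => _; [exact: MatrixCol|exact: MatrixRow].
Qed.

(** The matrices that occur in [centralizes]: one term, with the variables below [m] moved along [a]
    and the others along [b]. *)
Definition term_matrix a b p q r s := exists t m (e e' f f' : nat -> A),
  [/\ forall n, a (e n) (e' n), forall n, b (f n) (f' n) &
   [/\ p = eval (mixv m e f) t, q = eval (mixv m e f') t,
       r = eval (mixv m e' f) t & s = eval (mixv m e' f') t]].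

(* The variables of the k-th argument are renamed to those congruent to k modulo
   the arity, those of the second block being shifted past all of the first. *)
Lemma term_matrix_op a b i (p q r s : 'I_(ar i) -> A) :
  (forall x, a x x) -> (forall x, b x x) ->
  (forall k, term_matrix a b (p k) (q k) (r k) (s k)) ->
  term_matrix a b (op p) (op q) (op r) (op s).
Proof.
move=> axx bxx h.
have /choice[t /choice[m /choice[e /choice[e' /choice[f /choice[f' H]]]]]] := h.
have [n0|n0] := posnP (ar i).
  pose v : nat -> A := fun=> op p.
  exists (App (fun k : 'I_(ar i) => Var _ 0)), 0, v, v, v, v.
  have E (g g' : 'I_(ar i) -> A) : g = g'.
    by apply/funext => k; exfalso; case: k => k; rewrite n0.
  by split=> //; split=> /=; congr op; exact: E.
set N := ar i in t m e e' f f' H *.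
pose ord j : 'I_(ar i) := Ordinal (ltn_pmod j n0).
pose M := N * \max_k m k.
pose var (k : 'I_(ar i)) j :=
  if j < m k then Var S (k + j * N) else Var S (M + (k + j * N)).
pose E (w : 'I_(ar i) -> nat -> A) j := w (ord j) (j %/ N).
pose F (w : 'I_(ar i) -> nat -> A) j := E w (j - M).
exists (App (fun k : 'I_(ar i) => tsubst (var k) (t k))), M, (E e), (E e'), (F f), (F f').
have key k w w' : eval (mixv M (E w) (F w')) (tsubst (var k) (t k)) =
                  eval (mixv (m k) (w k) (w' k)) (t k).
  rewrite eval_tsubst; congr eval; apply/funext => j.
  have ordE : ord (k + j * N) = k.
    by apply: val_inj; rewrite /= addnC modnMDl modn_small //; exact: ltn_ord.
  have divE : (k + j * N) %/ N = j.
    by rewrite divnDr ?dvdn_mull // mulnK // divn_small ?add0n //; exact: ltn_ord.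
  rewrite /mixv /var; case: ifP => jm /=.
    suff -> : k + j * N < M by rewrite /E ordE divE.
    have jM : j < \max_k m k by apply: leq_trans jm _; exact: leq_bigmax.
    apply: (@leq_trans (j.+1 * N)); first by rewrite mulSn ltn_add2r; exact: ltn_ord.
    by rewrite mulnC leq_mul2l jM orbT.
  by rewrite ltnNge leq_addr /= /F addKn /E ordE divE.
split=> [j|j|].
- by have [he _ _] := H (ord j); exact: he.
- by have [_ hf _] := H (ord (j - M)); exact: hf.
- by split=> /=; congr op; apply/funext => k; rewrite key; have [_ _ []] := H k.
Qed.

Lemma matrix_term a b p q r s : is_con a -> is_con b ->
  matrix a b p q r s -> term_matrix a b p q r s.
Proof.
move=> ca cb; elim=> [x y xy|u v uv|i p0 q0 r0 s0 _ IH].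
- exists (Var _ 0), 1, (fun=> x), (fun=> y), (fun=> x), (fun=> x).
  by split=> // _; exact: con_refl.
- exists (Var _ 0), 0, (fun=> u), (fun=> u), (fun=> u), (fun=> v).
  by split=> // _; exact: con_refl.
- by apply: term_matrix_op => //; exact: con_refl.
Qed.

Lemma centralizesP a b d : is_con a -> is_con b -> centralizes a b d <-> invariant a b d.
Proof.
move=> ca cb; split=> [C p q r s /(matrix_term ca cb)|I t m e e' f f' he hf].
  case=> t [m [e [e' [f [f' [he hf [-> -> -> ->]]]]]]].
  exact: C.
by apply: I; exact: eval_matrix.
Qed.

Lemma matrix_sym a b p q r s : is_con a -> matrix a b p q r s -> matrix a b r s p q.
Proof.
move=> ca; elim=> [x y xy|u v uv|i p0 q0 r0 s0 _ IH].
- by apply: MatrixCol; exact: con_sym.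
- exact: MatrixRow.
- exact: MatrixOp.
Qed.

Lemma matrix_tr a b p q r s : matrix a b p q r s -> matrix b a p r q s.
Proof.
elim=> [x y xy|u v uv|i p0 q0 r0 s0 _ IH].
- exact: MatrixRow.
- exact: MatrixCol.
- exact: MatrixOp.
Qed.

Lemma matrix_row a b p q r s : is_con b -> matrix a b p q r s -> b p q /\ b r s.
Proof.
move=> cb; elim=> [x y xy|u v uv|i p0 q0 r0 s0 _ IH] //.
  by split; exact: con_refl.
by split; apply: con_op => // k; case: (IH k).
Qed.

Lemma matrix_col a b p q r s : is_con a -> matrix a b p q r s -> a p r /\ a q s.
Proof. by move=> ca /matrix_tr; exact: matrix_row. Qed.

Lemma con_comm a b : is_con (comm a b).
Proof.
split=> [x d cd _|]; first exact: con_refl.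
split=> [x y h d cd C|]; first by apply: con_sym => //; exact: h.
split=> [x y z h h' d cd C|i f g fg d cd C].
  by apply: (@con_trans _ _ _ cd y); [exact: h|exact: h'].
by apply: con_op => // k; exact: fg.
Qed.

Lemma centralizes_comm a b : centralizes a b (comm a b).
Proof. by move=> t m e e' f f' he hf h d cd C; apply: (C _ _ _ _ _ _ he hf); exact: h. Qed.

Lemma comm_ler a b : is_con a -> is_con b -> comm a b <=r b.
Proof.
move=> ca cb x y; apply=> //; apply/centralizesP => // p q r s.
by move=> /(matrix_row cb)[].
Qed.

Lemma comm_lel a b : is_con a -> is_con b -> comm a b <=r a.
Proof.
move=> ca cb x y; apply=> //; apply/centralizesP => // p q r s.
move=> /(matrix_col ca)[pr qs] pq; apply: (con_trans ca) qs.
exact: con_trans (con_sym ca pr) pq.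
Qed.

Lemma comm_mono a b c d : a <=r c -> b <=r d -> comm a b <=r comm c d.
Proof.
move=> ac bd x y h e ce C; apply: h => [|t m e1 e2 f1 f2 he hf] //.
exact: C (fun n => ac _ _ (he n)) (fun n => bd _ _ (hf n)).
Qed.

(** * The algebra of pairs of a congruence *)

Section PairAlgebra.
Variables (b : prel A) (cb : is_con b).

Definition pcar := {p : A * A | b p.1 p.2}.

Definition mkpair x y (h : b x y) : pcar := exist (fun p : A * A => b p.1 p.2) (x, y) h.

Definition pair_alg : algebra S :=
  @Algebra S pcar (fun i f => mkpair (con_op cb (fun k => proj2_sig (f k)))).

Definition fst_rel d : prel pair_alg := fun X Y => d (sval X).1 (sval Y).1.
Definition snd_rel d : prel pair_alg := fun X Y => d (sval X).2 (sval Y).2.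

Lemma con_fst_rel d : is_con d -> is_con (fst_rel d).
Proof.
move=> cd; split=> [X|]; first exact (con_refl cd _).
split=> [X Y h|]; first exact (con_sym cd h).
split=> [X Y Z h h'|i f g fg]; first exact (con_trans cd h h').
exact (con_op cd fg).
Qed.

Lemma con_snd_rel d : is_con d -> is_con (snd_rel d).
Proof.
move=> cd; split=> [X|]; first exact (con_refl cd _).
split=> [X Y h|]; first exact (con_sym cd h).
split=> [X Y Z h h'|i f g fg]; first exact (con_trans cd h h').
exact (con_op cd fg).
Qed.

Lemma eval_pair (v : nat -> pair_alg) t :
  sval (eval v t) = (eval (fun n => (sval (v n)).1) t, eval (fun n => (sval (v n)).2) t).
Proof.
elim: t => [n|i f IH] /=; first by case: (sval _).
by congr pair; congr op; apply/funext => k; rewrite IH.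
Qed.

Lemma models_pair (E : term S -> term S -> Prop) : models E A -> models E pair_alg.
Proof.
move=> mA s t st v; apply: eq_sig_hprop => [? ? ?|]; first exact: Prop_irrelevance.
by rewrite !eval_pair; congr pair; exact: mA.
Qed.

(** Matrices, read as relations between their two rows, are already reflexive, symmetric and
    compatible on the pairs of [b], so the transitive closure alone yields a congruence. *)
Definition delta_rel a : prel pair_alg :=
  tclos (A := pair_alg)
    (fun X Y => matrix a b (sval X).1 (sval X).2 (sval Y).1 (sval Y).2).

Lemma con_delta_rel a : is_con a -> is_con (delta_rel a).
Proof.
move=> ca; apply: con_tclos => [[[x y] xy]|X Y|i f g fg].
- exact: MatrixRow.
- exact: matrix_sym.
- exact: MatrixOp.
Qed.

Lemma delta_rel_saturated a d : invariant a b d -> forall X Y : pair_alg,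
  delta_rel a X Y -> d (sval X).1 (sval X).2 -> d (sval Y).1 (sval Y).2.
Proof.
move=> I; apply: (@tclos_saturated _ pair_alg _ (fun X => d (sval X).1 (sval X).2)).
by move=> X Y; exact: I.
Qed.

Lemma delta_rel_diag a x y : a x y ->
  delta_rel a (mkpair (con_refl cb x)) (mkpair (con_refl cb y)).
Proof. by move=> xy; apply: tclos_sub; exact: MatrixCol. Qed.

Lemma matrix_delta_rel a p q r s (pq : b p q) (rs : b r s) : matrix a b p q r s ->
  delta_rel a (mkpair pq) (mkpair rs).
Proof. by move=> h; apply: tclos_sub. Qed.

End PairAlgebra.
End Commutator.

(** * Monotonicity and symmetry of centrality under modularity *)

Section ModularCommutator.
Variables (S : signature) (A : algebra S) (b : prel A) (cb : is_con b).
Hypothesis modB : modular_con (pair_alg cb).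
Variable a : prel A.
Hypothesis ca : is_con a.

Lemma meet_proj_delta_rel :
  meet (snd_rel (cb := cb) (@Delta A)) (fst_rel (@Delta A)) <=r delta_rel (cb := cb) a.
Proof.
move=> [[x y] xy] [[x' y'] xy'] [/= e2 e1]; rewrite /snd_rel /fst_rel /Delta /= in e1 e2.
by subst x' y'; apply: tclos_sub; exact: MatrixRow.
Qed.

(** Shifting along the kernel of the second projection replaces (x, y), (x, y') by (y, y), (y, y').
    The first of these lies in [k], hence by saturation so does the second. *)
Lemma delta_rel_fst k : is_con k -> invariant a b k ->
  meet (delta_rel a) (fst_rel (@Delta A)) <=r snd_rel (cb := cb) k.
Proof.
move=> ck I [[x y] xy] [[x' y'] xy'] [D e]; rewrite /fst_rel /Delta /= in e; subst x'.
have yy' : b y y' := con_trans cb (con_sym cb xy) xy'.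
have cDel := @con_delta S A.
have := @shifting _ (pair_alg cb) _ _ _ (mkpair xy) (mkpair xy')
  (mkpair (con_refl cb y)) (mkpair yy') modB
  (con_snd_rel cb cDel) (con_fst_rel cb cDel) (con_delta_rel cb ca)
  meet_proj_delta_rel (erefl _) (erefl _) (erefl _) (erefl _) D.
by move=> /(delta_rel_saturated I); apply; exact: con_refl.
Qed.

Lemma delta_rel_snd k : is_con k -> invariant a b k ->
  meet (delta_rel a) (snd_rel (@Delta A)) <=r fst_rel (cb := cb) k.
Proof.
move=> ck I [[x y] xy] [[x' y'] xy'] [D e]; rewrite /snd_rel /Delta /= in e; subst y'.
have x'x : b x' x := con_trans cb xy' (con_sym cb xy).
have cDel := @con_delta S A.
have h : meet (fst_rel (cb := cb) (@Delta A)) (snd_rel (@Delta A)) <=r delta_rel (cb := cb) a.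
  by move=> X Y [h1 h2]; exact: meet_proj_delta_rel.
have := @shifting _ (pair_alg cb) _ _ _ (mkpair xy) (mkpair xy')
  (mkpair (con_refl cb x)) (mkpair x'x) modB
  (con_fst_rel cb cDel) (con_snd_rel cb cDel) (con_delta_rel cb ca)
  h (erefl _) (erefl _) (erefl _) (erefl _) D.
move=> /(delta_rel_saturated I) /= hk; apply: con_sym => //; apply: hk.
exact: con_refl.
Qed.

(* Shift along [delta_rel a] from the diagonal rows to the given ones. *)
Lemma invariant_mono k d : is_con k -> is_con d -> k <=r d ->
  invariant a b k -> invariant a b d.
Proof.
move=> ck cd kd I p q r s M pq.
have [bpq brs] := matrix_row cb M; have [apr aqs] := matrix_col ca M.
have h : meet (delta_rel a) (fst_rel (@Delta A)) <=r snd_rel (cb := cb) d.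
  by move=> X Y /(delta_rel_fst ck I) /kd.
exact: (@shifting _ (pair_alg cb) _ _ _ (mkpair (con_refl cb p)) (mkpair bpq)
  (mkpair (con_refl cb r)) (mkpair brs) modB (con_delta_rel cb ca)
  (con_fst_rel cb (@con_delta S A)) (con_snd_rel cb cd) h
  (delta_rel_diag cb apr) (matrix_delta_rel cb bpq brs M) (erefl _) (erefl _) pq).
Qed.

(** Shift along the kernel of the second projection from the rows (p, q), (r, s) to the diagonal
    pairs (q, q), (s, s): the relation of first coordinates under [k] is carried from p, r to q,
    s. *)
Lemma invariant_tr k : is_con k -> invariant a b k -> invariant b a k.
Proof.
move=> ck I p r q s /matrix_tr M pr.
have [bpq brs] := matrix_row cb M; have [apr aqs] := matrix_col ca M.
have h : meet (snd_rel (@Delta A)) (delta_rel a) <=r fst_rel (cb := cb) k.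
  by move=> X Y [h1 h2]; exact: (delta_rel_snd ck I).
exact: (@shifting _ (pair_alg cb) _ _ _ (mkpair bpq) (mkpair brs)
  (mkpair (con_refl cb q)) (mkpair (con_refl cb s)) modB
  (con_snd_rel cb (@con_delta S A)) (con_delta_rel cb ca) (con_fst_rel cb ck) h
  (erefl _) (erefl _) (matrix_delta_rel cb bpq brs M) (delta_rel_diag cb aqs) pr).
Qed.

End ModularCommutator.

(** * Additivity of centrality in its first argument *)

Section JoinInvariant.
Variables (S : signature) (A : algebra S) (b : prel A) (cb : is_con b).

Lemma pair_ext (X Y : pair_alg cb) : sval X = sval Y -> X = Y.
Proof. by apply: eq_sig_hprop => ? ? ?; exact: Prop_irrelevance. Qed.

(** This is the minimality of [delta_rel a] among the congruences that identify diagonal pairs along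
    [a]. *)
Lemma matrix_con (a : prel A) (T : prel (pair_alg cb)) : is_con T ->
  (forall x y, a x y -> T (mkpair (con_refl cb x)) (mkpair (con_refl cb y))) ->
  forall p q r s (pq : b p q) (rs : b r s), matrix a b p q r s ->
  T (mkpair pq) (mkpair rs).
Proof.
move=> cT aT p q r s pq rs M; move: M pq rs.
elim=> [x y xy|u v uv|i p0 q0 r0 s0 M IH] pq rs.
- rewrite (Prop_irrelevance pq (con_refl cb x)) (Prop_irrelevance rs (con_refl cb y)).
  exact: aT.
- by rewrite (Prop_irrelevance pq rs); exact (con_refl cT _).
have row k := matrix_row cb (M k).
have -> : mkpair pq = @op S (pair_alg cb) i (fun k => mkpair (proj1 (row k))).
  exact: pair_ext.
have -> : mkpair rs = @op S (pair_alg cb) i (fun k => mkpair (proj2 (row k))).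
  exact: pair_ext.
by apply: con_op => // k; exact: IH.
Qed.

Lemma con_diag (T : prel (pair_alg cb)) : is_con T ->
  is_con (fun x y => T (mkpair (con_refl cb x)) (mkpair (con_refl cb y))).
Proof.
move=> cT; split=> [x|]; first exact (con_refl cT _).
split=> [x y h|]; first exact (con_sym cT h).
split=> [x y z h h'|i f g fg]; first exact (con_trans cT h h').
have diag_op (h : 'I_(ar i) -> A) : mkpair (con_refl cb (op h)) =
    @op S (pair_alg cb) i (fun k => mkpair (con_refl cb (h k))).
  exact: pair_ext.
by rewrite !diag_op; exact: con_op.
Qed.

(** The join [D] of the two pair congruences restricts on the diagonal to a congruence of [A] above
    [a] and [a'], so [D] contains every matrix of the join. Saturation of [d] under both parts
    passes to [D]. *)
Lemma invariant_join a a' d : is_con a -> is_con a' ->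
  invariant a b d -> invariant a' b d -> invariant (join a a') b d.
Proof.
move=> ca ca' I I' p q r s M.
have [bpq brs] := matrix_row cb M.
pose D := join (delta_rel (cb := cb) a) (delta_rel a').
have cD : is_con D := con_join _ _.
have /(_ p q r s bpq brs M) : forall p q r s (pq : b p q) (rs : b r s),
    matrix (join a a') b p q r s -> D (mkpair pq) (mkpair rs).
  apply: matrix_con => //; apply: (join_lub (con_diag cD)) => x y xy.
    by apply: join_ubl; exact: delta_rel_diag.
  by apply: join_ubr; exact: delta_rel_diag.
exact (join_saturated (P := fun X : pair_alg cb => d (sval X).1 (sval X).2)
  (con_delta_rel cb ca) (con_delta_rel cb ca') (@delta_rel_saturated _ _ _ cb _ _ I)
  (@delta_rel_saturated _ _ _ cb _ _ I') (x := mkpair bpq) (y := mkpair brs)).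
Qed.

End JoinInvariant.

(** * Quotients and the correspondence of congruences *)

Section Quotient.
Variables (S : signature) (A : algebra S) (th : prel A) (cth : is_con th).

Lemma cls_eq x y : cls th x = cls th y <-> th x y.
Proof.
split=> [[e]|xy]; first by rewrite e; exact: con_refl.
apply: eq_sig_hprop => [? ? ?|] /=; first exact: Prop_irrelevance.
apply/funext => z; apply/propext; split=> h; last exact: con_trans xy h.
exact: con_trans (con_sym cth xy) h.
Qed.

Lemma repK (X : quot th) : cls th (rep X) = X.
Proof.
rewrite /rep; case: ClassicalEpsilon.constructive_indefinite_description => x /= e.
by apply: eq_sig_hprop => [? ? ?|] //=; exact: Prop_irrelevance.
Qed.

Lemma rep_cls x : th (rep (cls th x)) x.
Proof. by apply/cls_eq; rewrite repK. Qed.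

Lemma cls_op i (f : 'I_(ar i) -> A) :
  @op S (quot th) i (fun k => cls th (f k)) = cls th (op f).
Proof. by apply/cls_eq; apply: con_op => // k; exact: rep_cls. Qed.

Lemma eval_quot (v : nat -> A) t :
  eval (A := quot th) (fun n => cls th (v n)) t = cls th (eval v t).
Proof.
elim: t => [n|i f IH] //=.
transitivity (@op S (quot th) i (fun k => cls th (eval v (f k)))); last exact: cls_op.
exact: (f_equal (@op S (quot th) i) (funext IH)).
Qed.

Lemma models_quot (E : term S -> term S -> Prop) : models E A -> models E (quot th).
Proof.
move=> mA s t st v.
have -> : v = fun n => cls th (rep (v n)) by apply/funext => n; rewrite repK.
by rewrite !eval_quot (mA _ _ st).
Qed.

Definition pull (be : prel (quot th)) : prel A := fun x y => be (cls th x) (cls th y).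

(** Inverse to [pull] on the congruences above [th], where the choice of representatives does not
    matter. *)
Definition push (a : prel A) : prel (quot th) := fun X Y => a (rep X) (rep Y).

Lemma con_pull be : is_con be -> is_con (pull be).
Proof.
move=> cbe; split=> [x|]; first exact (con_refl cbe _).
split=> [x y h|]; first exact (con_sym cbe h).
split=> [x y z h h'|i f g fg]; first exact (con_trans cbe h h').
by rewrite /pull -!cls_op; exact: (con_op cbe).
Qed.

Lemma le_pull be : is_con be -> th <=r pull be.
Proof. by move=> cbe x y /cls_eq; rewrite /pull => ->; exact (con_refl cbe _). Qed.

Lemma con_push a : is_con a -> th <=r a -> is_con (push a).
Proof.
move=> ca tha; split=> [x|]; first exact (con_refl ca _).
split=> [x y h|]; first exact (con_sym ca h).
split=> [x y z h h'|i f g fg]; first exact (con_trans ca h h').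
rewrite /push /=; apply: (con_trans ca) (_ : a _ (op (fun k => rep (f k)))) _.
  by apply: tha; exact: rep_cls.
apply: (con_trans ca) (_ : a _ (op (fun k => rep (g k)))) _.
  exact: (con_op ca).
by apply: con_sym => //; apply: tha; exact: rep_cls.
Qed.

Lemma push_cls a x y : is_con a -> th <=r a -> push a (cls th x) (cls th y) <-> a x y.
Proof.
move=> ca tha; have r z : a (rep (cls th z)) z by apply: tha; exact: rep_cls.
split=> h.
  by apply: (con_trans ca) (r y); apply: (con_trans ca) h; exact: (con_sym ca).
by apply: (con_trans ca) (con_sym ca (r y)); exact: (con_trans ca) h.
Qed.

Lemma pushK a : is_con a -> th <=r a -> pull (push a) = a.
Proof. by move=> ca tha; apply: releq_ext => x y; exact: push_cls. Qed.

Lemma pullK be : push (pull be) = be.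
Proof. by apply: releq_ext => X Y; rewrite /push /pull !repK. Qed.

Lemma compl_pull be ga : is_compl be ga ->
  meet (pull be) (pull ga) <=r th /\ @Nabla A <=r join (pull be) (pull ga).
Proof.
move=> /is_complP[cbe cga mbg jbg]; split=> [x y [h1 h2]|x y _ T cT TU].
  by apply/cls_eq; apply: mbg.
have bT : pull be <=r T by move=> u v h; apply: TU; left.
have gT : pull ga <=r T by move=> u v h; apply: TU; right.
have thT : th <=r T := psubrel_trans (le_pull cbe) bT.
apply/(push_cls x y cT thT); apply: jbg (I : Nabla (cls th x) (cls th y)) _ _ _.
  exact: con_push.
by move=> X Y [h|h]; [apply: bT|apply: gT]; rewrite /pull !repK.
Qed.

Lemma compl_push f g : is_con f -> is_con g -> th <=r f -> th <=r g ->
  meet f g <=r th -> @Nabla A <=r join f g -> is_compl (push f) (push g).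
Proof.
move=> cf cg thf thg mfg jfg; apply/is_complP; split; try exact: con_push.
  by move=> X Y [h1 h2]; rewrite -(repK X) -(repK Y); apply/cls_eq; apply: mfg.
move=> X Y _ T cT TU.
suff : pull T (rep X) (rep Y) by rewrite /pull !repK.
apply: jfg I _ _ _; first exact: con_pull.
by move=> x y [h|h]; apply: TU; [left|right]; apply/push_cls.
Qed.

Lemma qcon_pull a : is_con a -> pull (@qcon S A th a) = join a th.
Proof.
move=> ca; apply: releq_ext => x y; split; last by move=> h; exists x, y.
have cj := con_join a th.
have thj : th <=r join a th by exact: join_ubr.
case=> u [v [/cls_eq xu [/cls_eq yv uv]]].
apply: (con_trans cj) (thj _ _ xu) _.
exact: (con_trans cj) uv (con_sym cj (thj _ _ yv)).
Qed.

End Quotient.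

(** * Compact congruences and maximal congruences *)

Section Compactness.
Variables (S : signature) (A : algebra S).
Implicit Types a b c d : prel A.

Definition union_of (J : Type) (F : J -> prel A) (s : list J) : prel A :=
  fun x y => exists j, List.In j s /\ F j x y.

Lemma In_mem (T : eqType) (x : T) s : x \in s -> List.In x s.
Proof.
elim: s => [|y s IH] //; rewrite inE => /orP[/eqP ->|/IH]; first by left.
by right.
Qed.

Lemma cg_mono (U U' : prel A) : U <=r U' -> cg U <=r cg U'.
Proof. by move=> UU'; apply: cg_lub (con_cg _) _ => x y /UU'; exact: cg_ub. Qed.

Lemma cg_union_mono J (F : J -> prel A) s s' : (forall j, List.In j s -> List.In j s') ->
  cg (union_of F s) <=r cg (union_of F s').
Proof. by move=> ss'; apply: cg_mono => x y [j [/ss' js Fj]]; exists j. Qed.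

(** The pairs reached from finite subfamilies already form a congruence: since arities are finite,
    the lists used for the arguments of an operation can be concatenated. *)
Lemma cg_finite J (F : J -> prel A) x y :
  cg (fun x y => exists j, F j x y) x y -> exists s, cg (union_of F s) x y.
Proof.
have con_F s : is_con (cg (union_of F s)) by exact: con_cg.
move=> /(_ (fun x y => exists s, cg (union_of F s) x y)); apply=> [|u v [j Fj]]; last first.
  by exists [:: j]; apply: cg_ub; exists j; split=> //; left.
split=> [u|]; first by exists [::]; exact (con_refl (con_F _) u).
split=> [u v [s h]|]; first by exists s; exact (con_sym (con_F s) h).
split=> [u v w [s h] [s' h']|i f g fg].
  exists (s ++ s'); apply: (con_trans (con_F _)) (_ : _ u v) (_ : _ v w).
    by apply: cg_union_mono h => j js; apply/List.in_or_app; left.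
  by apply: cg_union_mono h' => j js; apply/List.in_or_app; right.
have [s hs] := choice fg.
exists (List.flat_map s (enum 'I_(ar i))).
apply: (con_op (con_F _)) => k; apply: cg_union_mono (hs k) => j js.
by apply/List.in_flat_map; exists k; split=> //; apply: In_mem; rewrite mem_enum.
Qed.

Lemma compact_cg (l : list (A * A)) : compact (cg (fun x y => List.In (x, y) l)).
Proof.
split=> [|J F cF h]; first exact: con_cg.
have {h} : forall x y, List.In (x, y) l -> exists s, cg (union_of F s) x y.
  by move=> x y xy; apply: cg_finite; apply: h; exact: cg_ub.
move=> h; suff [s hs] : exists s, forall x y, List.In (x, y) l -> cg (union_of F s) x y.
  by exists s; apply: cg_lub (con_cg _) hs.
elim: l h => [|[u v] l IH] h; first by exists [::].
have [|s hs] := IH; first by move=> x y xy; apply: h; right.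
have [|s' hs'] := h u v; first by left.
exists (s' ++ s) => x y [[<- <-]|/hs].
  by apply: cg_union_mono hs' => j js; apply/List.in_or_app; left.
by apply: cg_union_mono => j js; apply/List.in_or_app; right.
Qed.

Lemma maximal_above nu : compact (@Nabla A) -> is_con nu -> ~ @Nabla A <=r nu ->
  exists2 m, maximal_con m & nu <=r m.
Proof.
move=> [_ cpt] cnu pnu.
(* Zorn's lemma is applied to sets of pairs adjoined to [nu], so that even the empty chain has a
   union above [nu]. *)
pose ext (X : A * A -> Prop) : prel A := fun x y => nu x y \/ X (x, y).
pose P X := is_con (ext X) /\ ~ @Nabla A <=r ext X.
have [F FP Ftot|X [[cX pX] Xmax]] := @classical_sets.Zorn_bigcup (A * A)%type P.
  pose U := classical_sets.bigcup F id.
  (* The index [None] stands for [nu] itself, which makes the family directed and nonempty for every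
     chain. *)
  pose G (o : option {X | F X}) := if o is Some X then ext (sval X) else nu.
  have cG o : is_con (G o) by case: o => [[X FX]|] //=; case: (FP _ FX).
  have GU o : G o <=r ext U.
    case: o => [[X FX]|] x y /=; last by left.
    by case; [left|right; exists X].
  have UG x y : ext U x y -> exists o, G o x y.
    case=> [h|[X FX h]]; first by exists None.
    by exists (Some (exist _ X FX)); right.
  have Gdir o o' : exists o'', G o <=r G o'' /\ G o' <=r G o''.
    case: o o' => [X|] [Y|]; [|by exists (Some X); split=> // x y h; left
      |by exists (Some Y); split=> // x y h; left|by exists None; split].
    have [XY|YX] := Ftot _ _ (proj2_sig X) (proj2_sig Y).
      by exists (Some Y); split=> // x y [h|/XY h]; [left|right].
    by exists (Some X); split=> // x y [h|/YX h]; [left|right].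
  have Gfin (s : list (option {X | F X})) :
      exists o, forall o', List.In o' s -> G o' <=r G o.
    elim: s => [|o s [o1 IH]]; first by exists None.
    have [o2 [h1 h2]] := Gdir o o1; exists o2 => o' [<-//|/IH h].
    exact: psubrel_trans h h2.
  have cU : is_con (ext U).
    split=> [x|]; first by left; exact: con_refl.
    split=> [x y /UG[o h]|]; first by apply: GU (con_sym (cG o) h).
    split=> [x y z /UG[o h] /UG[o' h']|i f g fg].
      have [o2 [h1 h2]] := Gdir o o'.
      by apply: (GU o2); apply: (con_trans (cG o2)) (h1 _ _ h) (h2 _ _ h').
    have /choice[o ho] := fun k => UG _ _ (fg k).
    have [o2 h2] := Gfin (List.map o (enum 'I_(ar i))).
    apply: (GU o2); apply: (con_op (cG o2)) => k; apply: h2 (ho k).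
    by apply: List.in_map; apply: In_mem; rewrite mem_enum.
  split=> // hU.
  (* If the union were [Nabla], compactness and directedness would make a single proper member equal
     to it. *)
  have [|s hs] := cpt _ G cG; first by move=> x y /hU/UG; exact: cg_ub.
  have [o ho] := Gfin s.
  have : @Nabla A <=r G o.
    by apply: psubrel_trans hs _; apply: cg_lub => // x y [j [/ho]]; apply.
  by case: (o) => [[Y FY]|] //=; case: (FP _ FY).
exists (ext X); last by move=> x y; left.
split=> //; split=> [/releq_nabla//|q cq Xq].
have [hq|pq] := pselect (@Nabla A <=r q); [by right; apply/releq_nabla|left].
have [qX|qX] := pselect (q <=r ext X); first by move=> x y; split; [exact: qX|exact: Xq].
exfalso; apply: (Xmax (fun p => q p.1 p.2)).
  split=> [[x y] h|h]; first by apply: Xq; right.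
  by apply: qX => x y xy; right; apply: (h (x, y)).
suff e : ext (fun p => q p.1 p.2) = q by rewrite /P e.
by apply: psubrel_anti => x y; [case=> // h; apply: Xq; left|right].
Qed.

End Compactness.

(** * Commutator calculus in a semidegenerate modular variety *)

Section Variety.
Variables (S : signature) (E : term S -> term S -> Prop).
Hypotheses (modE : congruence_modular E) (semE : semidegenerate E).
Variables (A : algebra S) (HA : models E A).
Implicit Types a b c d : prel A.

Lemma modular_pair b (cb : is_con b) : modular_con (pair_alg cb).
Proof. by apply: modE; exact: models_pair. Qed.

(** The commutator is itself centralizing, and centrality passes to every larger congruence. *)
Lemma invariantP a b d : is_con a -> is_con b -> is_con d ->
  invariant a b d <-> comm a b <=r d.
Proof.
move=> ca cb cd; split=> [I x y|h]; first by apply=> //; apply/centralizesP.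
refine (invariant_mono (@modular_pair b cb) ca (con_comm a b) cd h _).
by apply/centralizesP => //; exact: centralizes_comm.
Qed.

Lemma comm_sym a b : is_con a -> is_con b -> comm a b <=r comm b a.
Proof.
move=> ca cb; have cc := con_comm b a.
by apply/invariantP => //; refine (invariant_tr (@modular_pair a ca) cb cc _); apply/invariantP.
Qed.

Lemma comm_join_lub a b c d : is_con a -> is_con b -> is_con c -> is_con d ->
  comm a c <=r d -> comm b c <=r d -> comm (join a b) c <=r d.
Proof.
move=> ca cb cc cd ad bd; apply/invariantP => //; first exact: con_join.
by apply: invariant_join => //; apply/invariantP.
Qed.

(* The diagonal of the pair algebra of [a] becomes a one-element subalgebra modulo
   [delta_rel Nabla], so semidegeneracy makes that quotient trivial. *)
Lemma comm_nabla a : is_con a -> a <=r comm (@Nabla A) a.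
Proof.
move=> ca x y axy d cd /centralizesP I.
have {}I := I (@con_nabla S A) ca.
have cD := con_delta_rel ca (@con_nabla S A).
set D := delta_rel _ in cD.
have [h|h] := pselect (exists X Y : quot D, X <> Y).
  exfalso; apply: (semE (models_quot cD (models_pair (cb := ca) HA)) h).
  exists (cls D (mkpair (con_refl ca x))) => i f /funext ->.
  rewrite cls_op //; apply/cls_eq => //.
  exact: (@matrix_delta_rel _ _ _ ca _ _ _ x x (con_op _ _) _ (MatrixCol _ _)).
(* In a trivial quotient (x, x) and (x, y) are identified, and saturation carries [d x x] over to
   [d x y]. *)
have /cls_eq -/(_ cD) : cls D (mkpair (con_refl ca x)) = cls D (mkpair axy).
  by apply: contrapT => ne; apply: h; eexists; eexists; exact: ne.
by move=> /(delta_rel_saturated I); apply; exact: con_refl.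
Qed.

(* The congruence generated by the pairs (x, f(x, ..., x)), one for each of the
   finitely many symbols f, makes the class of x a one-element subalgebra. *)
Lemma compact_nabla : compact (@Nabla A).
Proof.
have [[x _]|h] := pselect (exists x : A, True); last first.
  (* In an empty algebra the empty subfamily suffices. *)
  split=> // J F cF _; exists [::] => x; exfalso; apply: h; by exists x.
pose l := List.map (fun i => (x, @op S A i (fun=> x))) (enum (sym S)).
suff -> : @Nabla A = cg (fun x y => List.In (x, y) l) by exact: compact_cg.
set U := (fun x y => _); have cU : is_con (cg U) := con_cg U.
apply: psubrel_anti => // y z _; apply/(cls_eq cU); apply: contrapT => ne.
apply: (semE (models_quot cU HA)); first by eexists; eexists; exact: ne.
exists (cls (cg U) x) => i f /funext ->; rewrite cls_op //; apply/cls_eq => //.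
apply: (con_sym cU); apply: cg_ub.
by apply: (List.in_map (fun i => (x, @op S A i (fun=> x)))); apply: In_mem; rewrite mem_enum.
Qed.


(** A case analysis along a cover: [a] lies in [Nabla, a], which additivity splits into [f, a] and
    [g, a]. It stands in for distributivity below. *)
Lemma le_of_cover f g a d : is_con f -> is_con g -> is_con a -> is_con d ->
  @Nabla A <=r join f g -> comm f a <=r d -> comm g a <=r d -> a <=r d.
Proof.
move=> hf hg ca cd fg fd gd; apply: psubrel_trans (comm_nabla ca) _.
apply: (@psubrel_trans _ _ (comm (join f g) a)); first exact: comm_mono.
exact: comm_join_lub.
Qed.

(** Split f /\ g along the cover; both [f, f /\ g] and [g, f /\ g] lie in [f, g]. *)
Lemma meet_le_of_comm f g d : is_con f -> is_con g -> is_con d ->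
  @Nabla A <=r join f g -> comm f g <=r d -> meet f g <=r d.
Proof.
move=> hf hg cd fg fgd; apply: (le_of_cover hf hg (con_meet hf hg) cd fg).
  apply: psubrel_trans fgd; apply: comm_mono => //; exact: meet_ler.
apply: psubrel_trans fgd; apply: psubrel_trans (comm_sym hg hf).
by apply: comm_mono => //; exact: meet_lel.
Qed.

Lemma comm_compl e e' d : is_compl e e' -> is_con d -> comm e e' <=r d.
Proof.
move=> /is_complP[ce ce' mee' _] cd; apply: psubrel_trans (delta_le cd).
by apply: psubrel_trans mee'; apply: meet_glb; [exact: comm_lel|exact: comm_ler].
Qed.

Lemma compl_le e e' g : is_compl e e' -> is_con g -> @Nabla A <=r join e g -> e' <=r g.
Proof.
move=> ee' hg eg; have /is_complP[ce ce' _ _] := ee'.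
apply: (le_of_cover ce hg ce' hg eg); [exact: comm_compl|exact: comm_lel].
Qed.

(** In the additive expansion every term other than [a, b] has [t] as an argument. *)
Lemma comm_join_join a b t d : is_con a -> is_con b -> is_con t -> is_con d ->
  comm a b <=r d -> t <=r d -> comm (join a t) (join b t) <=r d.
Proof.
move=> ca cb ct cd abd td.
have cjb := con_join b t; have cja := con_join a t.
have leT c c' : is_con c -> is_con c' -> c <=r d -> comm c c' <=r d.
  by move=> cc cc' cd'; apply: psubrel_trans cd'; exact: comm_lel.
apply: comm_join_lub => //; last exact: leT.
apply: (psubrel_trans (comm_sym ca cjb)); apply: comm_join_lub => //; last exact: leT.
exact: psubrel_trans (comm_sym cb ca) abd.
Qed.

Lemma boolean_join a b : boolean a -> boolean b -> boolean (join a b).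
Proof.
move=> [a' aa'] [b' bb']; exists (meet a' b').
have /is_complP[ca ca' _ ja] := aa'; have /is_complP[cb cb' _ jb] := bb'.
have cm := con_meet ca' cb'; have cj := con_join a b.
set j := join (join a b) (meet a' b').
have cjj : is_con j := con_join _ _.
have jN : @Nabla A <=r j.
  apply: psubrel_trans ja _; apply: join_lub => //.
    by apply: le_joinl; exact: join_ubl.
  (* Split a' along b and b': [b, a'] lies in b, and [b', a'] lies in a' /\ b'. *)
  apply: (le_of_cover cb cb' ca' cjj jb).
    apply: psubrel_trans (comm_lel cb ca') _; apply: le_joinl; exact: join_ubr.
  apply: le_joinr; apply: meet_glb; [exact: comm_ler|exact: comm_lel].
apply/is_complP; split=> //; apply: meet_le_of_comm => //; first exact: con_delta.
apply: comm_join_lub => //; first exact: con_delta.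
  apply: psubrel_trans (comm_compl aa' (@con_delta _ A)).
  by apply: comm_mono => //; exact: meet_lel.
apply: psubrel_trans (comm_compl bb' (@con_delta _ A)).
by apply: comm_mono => //; exact: meet_ler.
Qed.

Lemma compact_le_join_diamond a t m : compact a -> is_con t -> is_con m ->
  a <=r join t (diamond m) -> exists e, [/\ boolean e, e <=r m & a <=r join t e].
Proof.
move=> [_ cpt] ct cm atm.
(* The index [None] stands for [t], so one family covers both parts of the join. *)
pose F (o : option {e | boolean e /\ e <=r m}) := if o is Some e then sval e else t.
have cF o : is_con (F o) by case: o => [[e [be em]]|] //=; exact: con_boolean.
have [|s hs] := cpt _ F cF.
  apply: psubrel_trans atm _; apply: join_lub (con_cg _) _ _.
    by move=> x y h; apply: cg_ub; exists None.
  apply: cg_lub (con_cg _) _ => x y [e [be [em exy]]].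
  by apply: cg_ub; exists (Some (exist _ e (conj be em))).
suff [e [be em he]] :
    exists e, [/\ boolean e, e <=r m & forall o, List.In o s -> F o <=r join t e].
  exists e; split=> //; apply: psubrel_trans hs _.
  by apply: cg_lub (con_join _ _) _ => x y [o [/he]]; apply.
elim: s {hs} => [|o s [e [be em he]]].
  by exists (@Delta A); split=> //; [exact: boolean_delta|exact: delta_le].
case: o => [[e' [be' em']]|].
  exists (join e' e); split; [exact: boolean_join|exact: join_lub|].
  move=> o [<-|/he h] /=; first by apply: le_joinr; exact: join_ubl.
  by apply: (psubrel_trans h); apply: join_mono => //; exact: join_ubr.
by exists e; split=> // o [<-|/he//]; exact: join_ubl.
Qed.

(** By compactness finitely many pairs, each from [f] or from [g], generate [Nabla]; sorting them by
    origin gives the two finitely generated parts. *)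
Lemma compact_cover f g : is_con f -> is_con g -> @Nabla A <=r join f g ->
  exists f0 g0, [/\ compact f0, compact g0, f0 <=r f, g0 <=r g & @Nabla A <=r join f0 g0].
Proof.
move=> hf hg fg; have [_ cpt] := compact_nabla.
pose J := {p : A * A | f p.1 p.2 \/ g p.1 p.2}.
pose F (j : J) := cg (fun x y => (x, y) = sval j).
have [j||s hs] := cpt J F; first exact: con_cg.
  apply: psubrel_trans fg _.
  have sub (c : prel A) : (forall x y, c x y -> f x y \/ g x y) ->
      c <=r cg (fun x y => exists j, F j x y).
    move=> cfg x y /cfg h; apply: cg_ub.
    by exists (exist (fun p : A * A => f p.1 p.2 \/ g p.1 p.2) (x, y) h); exact: cg_ub.
  by apply: join_lub (con_cg _) _ _; apply: sub => x y; [left|right].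
pose gen (l : list (A * A)) := cg (fun x y => List.In (x, y) l).
suff [l [l' [lf lg hl]]] : exists l l', [/\ gen l <=r f, gen l' <=r g &
    forall j, List.In j s -> F j <=r join (gen l) (gen l')].
  exists (gen l), (gen l'); split=> //; try exact: compact_cg.
  apply: psubrel_trans hs _.
  by apply: cg_lub (con_join _ _) _ => x y [j [/hl]]; apply.
elim: s {hs} => [|[[u v] uv] s [l [l' [lf lg hl]]]].
  by exists [::], [::]; split=> //; apply: cg_lub.
have sub (p : A * A) l0 : gen l0 <=r gen (p :: l0).
  by apply: cg_mono => x y h; right.
have gF l0 h : F (exist _ (u, v) h) <=r gen ((u, v) :: l0).
  by apply: cg_mono => x y ->; left.
have gcons c l0 : is_con c -> c u v -> gen l0 <=r c -> gen ((u, v) :: l0) <=r c.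
  move=> cc cuv l0c; apply: cg_lub => // x y [[<- <-]//|h]; apply: l0c; exact: cg_ub.
case: (uv) => [fuv|guv].
  exists ((u, v) :: l), l'; split=> //; first exact: gcons.
  move=> j [<-|/hl h]; first by apply: le_joinl; exact: gF.
  by apply: (psubrel_trans h); apply: join_mono.
exists l, ((u, v) :: l'); split=> //; first exact: gcons.
move=> j [<-|/hl h]; first by apply: le_joinr; exact: gF.
by apply: (psubrel_trans h); apply: join_mono.
Qed.

Lemma maximal_boolean (m e e' : prel A) : maximal_con m -> is_compl e e' -> e <=r m \/ e' <=r m.
Proof.
move=> [cm [_ mmax]] ee'; have [ce _ _ _] := proj1 (is_complP _ _) ee'.
have [h|/releq_nabla h] := mmax _ (con_join e m) (@join_ubr _ _ _ _).
  by left=> x y xy; apply/h; exact: join_ubl.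
by right; exact: compl_le ee' cm h.
Qed.

(** Condition (2), the pivot with which each of the other conditions is compared. *)
Definition splits (th : prel A) := forall phi psi, is_con phi -> is_con psi ->
  releq (join phi psi) (@Nabla A) -> psubrel (comm phi psi) th ->
  exists al nal, is_compl al nal /\
    psubrel al (join th phi) /\ psubrel nal (join th psi).

(** * Lifting of complemented congruences as a splitting property *)

Variables (th : prel A) (cth : is_con th).

Lemma cover_mono f g f' g' : f <=r f' -> g <=r g' ->
  @Nabla A <=r join f g -> @Nabla A <=r join f' g'.
Proof. by move=> ff' gg' h; apply: psubrel_trans h _; exact: join_mono. Qed.

Lemma quot_compl t f g : is_con t -> is_con f -> is_con g ->
  @Nabla A <=r join f g -> comm f g <=r t ->
  is_compl (push (th := t) (join f t)) (push (join g t)).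
Proof.
move=> ct hf hg fg fgt.
have cft := con_join f t; have cgt := con_join g t.
have N : @Nabla A <=r join (join f t) (join g t).
  by apply: cover_mono fg; exact: join_ubl.
apply: compl_push => //; try exact: join_ubr.
by apply: meet_le_of_comm => //; exact: comm_join_join.
Qed.

Lemma CBLP_splits : CBLP th -> splits th.
Proof.
move=> lift phi psi cphi cpsi /releq_nabla N C.
have pp := quot_compl cth cphi cpsi N C.
have [al [[nal ann] /releq_ext qal]] := lift _ (ex_intro _ _ pp).
have [cal cnal _ _] := proj1 (is_complP _ _) ann.
have e : join al th = join phi th.
  rewrite -(qcon_pull cth cal) qal pushK //; [exact: con_join|exact: join_ubr].
exists al, nal; split=> //; split.
  by apply: psubrel_trans (@join_sym _ _ _ _); rewrite -e; exact: join_ubl.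
apply: psubrel_trans (@join_sym _ _ _ _).
(* The lift satisfies al \/ th = phi \/ th, so [al] and psi \/ th cover [Nabla], which forces the
   complement of [al] below psi \/ th. *)
apply: (compl_le ann (con_join psi th)).
have cj := con_join al (join psi th).
have hal : join al th <=r join al (join psi th).
  by apply: join_mono => //; exact: join_ubr.
apply: psubrel_trans N _; apply: join_lub => //.
  by apply: psubrel_trans hal; rewrite e; exact: join_ubl.
by apply: le_joinr; exact: join_ubl.
Qed.

Lemma splits_CBLP : splits th -> CBLP th.
Proof.
move=> sp be [ga bg]; have [cbe cga _ _] := proj1 (is_complP _ _) bg.
have [M N] := compl_pull cth bg.
set f := pull be in M N; set g := pull ga in M N.
have hf : is_con f := con_pull cth cbe; have hg : is_con g := con_pull cth cga.
have thf : th <=r f := le_pull cth cbe; have thg : th <=r g := le_pull cth cga.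
have [|al [nal [ann [af ng]]]] := sp f g hf hg (proj2 (releq_nabla _) N).
  by apply: psubrel_trans M; apply: meet_glb; [exact: comm_lel|exact: comm_ler].
have {}af : al <=r f by apply: psubrel_trans af _; exact: join_lub.
have {}ng : nal <=r g by apply: psubrel_trans ng _; exact: join_lub.
have [cal cnal _ jal] := proj1 (is_complP _ _) ann.
exists al; split; first by exists nal.
suff e : join al th = f.
  by rewrite -(pullK (@qcon S A th al)) qcon_pull // e /f pullK.
have cj := con_join al th; have cn := con_join nal th.
have jf : join al th <=r f by exact: join_lub.
apply: psubrel_anti => // x y fxy.
(* Modularity writes [f] as (al \/ th) \/ ((nal \/ th) /\ f); the second part lies in g /\ f, hence
   in [th]. *)
have : meet (join (join al th) (join nal th)) f x y.
  by split=> //; apply: cover_mono jal _ _ I; exact: join_ubl.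
move/(modE HA cj cn hf jf); apply: join_lub => // u v [h fuv].
apply: join_ubr; apply: M; split=> //.
by apply: join_lub h.
Qed.

(** Enlarging both congruences by [th] leaves the conclusion unchanged and turns the inclusion into
    an equality, since [th] lies in their meet and the meet of a covering pair lies in its
    commutator. *)
Lemma splits_of_eq :
  (forall phi psi, is_con phi -> is_con psi ->
      releq (join phi psi) (@Nabla A) -> releq (comm phi psi) th ->
      exists al nal, is_compl al nal /\
        psubrel al (join th phi) /\ psubrel nal (join th psi)) -> splits th.
Proof.
move=> h phi psi cphi cpsi /releq_nabla N C.
have hf := con_join phi th; have hg := con_join psi th.
have N' : @Nabla A <=r join (join phi th) (join psi th).
  by apply: cover_mono N; exact: join_ubl.
have [|x y|al [nal [ann [af ng]]]] := h _ _ hf hg.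
- exact/releq_nabla.
- split; first by apply: comm_join_join.
  move=> xy; apply: meet_le_of_comm (con_comm _ _) N' _ _ _ _ => //.
  by split; exact: join_ubr.
exists al, nal; split=> //.
by split; [apply: psubrel_trans af _|apply: psubrel_trans ng _];
  apply: join_lub (con_join _ _) _ _ => //; try exact: join_ubl; exact: join_sym.
Qed.

(** * The local condition at maximal congruences *)

Lemma splits_local phi : K_comm_closed A -> splits th -> maximal_con phi ->
  at_most_two_boolean (quot (join th (diamond phi))).
Proof.
move=> Kc sp mphi; have cphi : is_con phi by case: mphi.
set t := join th (diamond phi); have ct : is_con t := con_join _ _.
have tht : th <=r t by exact: join_ubl.
have dt e : boolean e -> e <=r phi -> e <=r t.
  by move=> be ephi; apply: le_joinr => x y exy; apply: cg_ub; exists e.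
(* Among three relations each equal to [Delta] or [Nabla], two coincide. *)
suff triv be : boolean be -> be = @Delta (quot t) \/ be = @Nabla (quot t).
  move=> a b c /triv[->|->] /triv[->|->] /triv[->|->];
    by [left | right; left | right; right].
move=> [ga bg]; have [cbe cga mbg _] := proj1 (is_complP _ _) bg.
have [M N] := compl_pull ct bg.
set f := pull be in M N; set g := pull ga in M N.
have hf : is_con f := con_pull ct cbe; have hg : is_con g := con_pull ct cga.
have tf : t <=r f := le_pull ct cbe; have tg : t <=r g := le_pull ct cga.
suff [fN|gN] : @Nabla A <=r f \/ @Nabla A <=r g.
- by right; rewrite -(pullK be); apply: psubrel_anti => // X Y _; exact: fN.
- left; rewrite -(pullK be); apply: psubrel_anti; last first.
    by apply: delta_le; exact: con_push.
  move=> X Y h; rewrite -(repK X) -(repK Y); apply/cls_eq => //.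
  by apply: M; split=> //; exact: gN.
have [f0 [g0 [kf0 kg0 ff0 gg0 N0]]] := compact_cover hf hg N.
have cf0 : is_con f0 by case: kf0. have cg0 : is_con g0 by case: kg0.
have [|al [bal alphi C]] := compact_le_join_diamond (Kc _ _ kf0 kg0) cth cphi.
  apply: psubrel_trans (comm_mono ff0 gg0) _.
  by apply: psubrel_trans M; apply: meet_glb; [exact: comm_lel|exact: comm_ler].
have [nal ann] := bal; have [cal cnal _ jal] := proj1 (is_complP _ _) ann.
pose ta := join th al; have cta : is_con ta := con_join _ _.
pose f1 := join f0 ta; pose g1 := join g0 ta.
have cf1 : is_con f1 := con_join _ _; have cg1 : is_con g1 := con_join _ _.
(* Only the part of [g1] under the complement of [al] is kept. The cover survives because [al] lies
   in [f1], and [f1, g2] now falls into [th] instead of th \/ al. *)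
pose g2 := comm nal g1; have cg2 : is_con g2 := con_comm _ _.
have g21 : g2 <=r g1 by exact: comm_ler.
have tat : ta <=r t by apply: join_lub => //; exact: dt.
have f1f : f1 <=r f by apply: join_lub => //; exact: psubrel_trans tat tf.
have g1g : g1 <=r g by apply: join_lub => //; exact: psubrel_trans tat tg.
have taf1 : ta <=r f1 by exact: join_ubr.
have tag1 : ta <=r g1 by exact: join_ubr.
have C1 : comm f1 g1 <=r ta by exact: comm_join_join.
have N2 : @Nabla A <=r join f1 g2.
  have cj := con_join f1 g2.
  apply: psubrel_trans (cover_mono (@join_ubl _ _ f0 ta) (@join_ubl _ _ g0 ta) N0) _.
  apply: join_lub => //; first exact: join_ubl.
  apply: (le_of_cover cal cnal cg1 cj jal); last exact: join_ubr.
  apply: psubrel_trans (comm_lel cal cg1) _; apply: le_joinl.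
  by apply: psubrel_trans taf1; exact: join_ubr.
have C2 : comm f1 g2 <=r th.
  have h1 : comm f1 g2 <=r ta by apply: psubrel_trans C1; exact: comm_mono.
  have h2 : comm f1 g2 <=r nal.
    by apply: psubrel_trans (comm_ler cf1 cg2) _; exact: comm_lel.
  apply: (le_of_cover cal cnal (con_comm _ _) cth jal).
    apply: psubrel_trans (comm_compl ann cth); exact: comm_mono.
  apply: (@psubrel_trans _ _ (comm nal ta)); first exact: comm_mono.
  apply: psubrel_trans (comm_sym cnal cta) _; apply: comm_join_lub => //.
    exact: comm_lel.
  exact: comm_compl.
have [e [ne [ene [ef neg]]]] := sp _ _ cf1 cg2 (proj2 (releq_nabla _) N2) C2.
have {}ef : e <=r f.
  by apply: psubrel_trans ef _; apply: join_lub => //; exact: psubrel_trans tht tf.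
have {}neg : ne <=r g.
  apply: psubrel_trans neg _; apply: join_lub => //; first exact: psubrel_trans tht tg.
  exact: psubrel_trans g21 g1g.
have [_ _ _ jee] := proj1 (is_complP _ _) ene.
(* The member of the pair that lies in [phi] lies in [t], hence in both [f] and [g]; one of these
   then contains both complements. *)
have [ephi|nephi] := maximal_boolean mphi ene.
  right; apply: psubrel_trans jee _; apply: join_lub => //.
  by apply: psubrel_trans tg; apply: dt => //; exists ne.
left; apply: psubrel_trans jee _; apply: join_lub => //.
by apply: psubrel_trans tf; apply: dt => //; exists e; exact: is_compl_sym.
Qed.

Lemma local_splits :
  (forall phi, maximal_con phi -> at_most_two_boolean (quot (join th (diamond phi)))) ->
  splits th.
Proof.
move=> loc phi psi cphi cpsi /releq_nabla N C.
pose f := join phi th; pose g := join psi th.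
have hf : is_con f := con_join _ _; have hg : is_con g := con_join _ _.
have thf : th <=r f by exact: join_ubr.
have thg : th <=r g by exact: join_ubr.
have fN : @Nabla A <=r join f g by apply: cover_mono N; exact: join_ubl.
have fgth : comm f g <=r th by exact: comm_join_join.
pose J := {e | boolean e /\ (e <=r f \/ e <=r g)}.
pose nu : prel A := cg (fun x y => exists j : J, sval j x y).
have cnu : is_con nu := con_cg _.
(* Some Boolean [e] below [m] already covers [Nabla] with [c]. Its complement then lies below [c],
   so in [nu] and in [m], and [m] contains both. *)
have cov m c : is_con m -> is_con c -> @Nabla A <=r join c (diamond m) ->
    c <=r f \/ c <=r g -> nu <=r m -> @Nabla A <=r m.
  move=> cm cc NN cfg num.
  have [e [[e' ee'] em Ne]] := compact_le_join_diamond compact_nabla cc cm NN.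
  have [ce ce' _ jee'] := proj1 (is_complP _ _) ee'.
  have e'c : e' <=r c.
    by apply: (compl_le ee' cc); apply: psubrel_trans Ne (@join_sym _ _ _ _).
  apply: psubrel_trans jee' _; apply: join_lub => //; apply: psubrel_trans num.
  have Je : boolean e' /\ (e' <=r f \/ e' <=r g).
    split; first by exists e; exact: is_compl_sym.
    by case: cfg => h; [left|right]; exact: psubrel_trans e'c h.
  by move=> x y h; apply: cg_ub; exists (exist _ e' Je).
have nuN : @Nabla A <=r nu.
  apply: contrapT => /(maximal_above compact_nabla cnu)[m mm num].
  have cm : is_con m by case: mm.
  have pm : ~ @Nabla A <=r m by case: mm => _ [h _] /releq_nabla.
  have {}loc := loc m mm; set t := join th (diamond m) in loc.
  have ct : is_con t := con_join _ _.
  have fd : t <=r join f (diamond m) by exact: join_mono.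
  have gd : t <=r join g (diamond m) by exact: join_mono.
  have bP : boolean (push (th := t) (join f t)).
    exists (push (join g t)); apply: quot_compl => //.
    by apply: psubrel_trans fgth _; exact: join_ubl.
  have hft := con_join f t.
  (* Two of [Delta], [Nabla] and the image of f \/ t coincide. In the first and third cases [f]
     covers together with [diamond m]; in the second [f] lies in [t], so [g] does. *)
  apply: pm; have [h|[h|h]] := loc _ _ _ (@boolean_delta _ _) (@boolean_nabla _ _) bP.
  - apply: (cov m f) => //; last by left.
    move=> x y _; apply: fd; apply/cls_eq => //; exact/(h (cls t x) (cls t y)).
  - apply: (cov m g) => //; last by right.
    apply: psubrel_trans fN _; apply: join_lub (con_join _ _) _ (@join_ubl _ _ _ _).
    apply: psubrel_trans gd => x y fxy; apply/cls_eq => //.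
    apply/(h (cls t x) (cls t y)); apply/push_cls => //; first exact: join_ubr.
    exact: join_ubl.
  - apply: (cov m f) => //; last by left.
    apply: (@psubrel_trans _ _ (join f t)); last first.
      by apply: join_lub (con_join _ _) (@join_ubl _ _ _ _) fd.
    move=> x y _; apply/(push_cls ct x y hft (@join_ubr _ _ _ _)).
    exact/(h (cls t x) (cls t y)).
have [_ cpt] := compact_nabla.
have [|s hs] := cpt J (fun j => sval j) _ nuN.
  by case=> e [be _] /=; exact: con_boolean.
(* Group the finitely many Booleans by whether they lie below [f] or [g]. As the groups cover
   [Nabla], the complement of [a] lies below [b], hence below [g]. *)
suff [a [b [[ba af] [bb bg] hab]]] : exists a b, [/\ boolean a /\ a <=r f,
    boolean b /\ b <=r g & forall j, List.In j s -> sval j <=r join a b].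
  have jab : @Nabla A <=r join a b.
    apply: psubrel_trans hs _.
    by apply: cg_lub (con_join _ _) _ => x y [j [/hab]]; apply.
  have [a' aa'] := ba; exists a, a'; split=> //.
  split; apply: psubrel_trans (@join_sym _ _ _ _) => //.
  by apply: psubrel_trans bg; apply: (compl_le aa' (con_boolean bb)).
elim: s {hs} => [|[e [be efg]] s [a [b [[ba af] [bb bg] hab]]]].
  exists (@Delta A), (@Delta A); split=> //; split; try exact: boolean_delta;
    exact: delta_le.
case: (efg) => h.
  exists (join e a), b; split=> //; first by split; [exact: boolean_join|exact: join_lub].
  move=> j [<-|/hab hj] /=; first by apply: le_joinl; exact: join_ubl.
  by apply: (psubrel_trans hj); apply: join_mono => //; exact: join_ubr.
exists a, (join e b); split=> //; first by split; [exact: boolean_join|exact: join_lub].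
move=> j [<-|/hab hj] /=; first by apply: le_joinr; exact: join_ubl.
by apply: (psubrel_trans hj); apply: join_mono => //; exact: join_ubr.
Qed.

End Variety.

Theorem theorem6p3 (S : signature) (E : term S -> term S -> Prop)
  (HV : standing E) (A : algebra S) (HA : models E A) (th : prel A) (Hth : is_con th) :
  (CBLP th <->
   (forall phi psi, is_con phi -> is_con psi ->
      releq (join phi psi) (@Nabla A) -> psubrel (comm phi psi) th ->
      exists al nal, is_compl al nal /\
        psubrel al (join th phi) /\ psubrel nal (join th psi)))
  /\
  (CBLP th <->
   (forall phi psi, is_con phi -> is_con psi ->
      releq (join phi psi) (@Nabla A) -> releq (comm phi psi) th ->
      exists al nal, is_compl al nal /\
        psubrel al (join th phi) /\ psubrel nal (join th psi)))
  /\
  (CBLP th <->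
   (forall phi, maximal_con phi ->
      at_most_two_boolean (quot (join th (diamond phi))))).
Proof.
have [modE [semE /(_ A HA)[Kc _]]] := HV.
have to_splits := CBLP_splits modE semE HA Hth.
have of_splits := splits_CBLP modE HA Hth.
split; first by split.
split; split.
- move=> /to_splits sp phi psi cphi cpsi N C.
  by apply: sp => // x y /C.
- by move=> /(splits_of_eq modE semE HA Hth)/of_splits.
- by move=> /to_splits sp phi; exact: (splits_local modE semE HA Hth).
- by move=> /(local_splits modE semE HA Hth)/of_splits.
Qed.
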